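(* For every integer $\sigma\ge 1$ there exist a positive integer $N(\sigma)$ and a real constant $C(\sigma)>0$, both depending only on $\sigma$, such that for every integer $n\ge N(\sigma)$ there exists an $n$-state cellular automaton rule $f:\mathbb{Z}_n^2\to\mathbb{Z}_n$ with $$X_{\sigma,n}(f)=Y_{\sigma,n}(f)\ge C(\sigma)\,n^\sigma.$$
   Context: Let $n\ge 2$ and $\mathbb{Z}_n=\{0,1,\dots,n-1\}$. A spatial configuration is a map $\xi:\mathbb{Z}\to\mathbb{Z}_n$. An $n$-state (two-neighbor, one-dimensional) cellular automaton (CA) rule is a function $f:\mathbb{Z}_n^2\to\mathbb{Z}_n$; it generates from an initial configuration $\xi_0$ the trajectory $\xi_0,\xi_1,\dots$ given by $\xi_{t+1}(x)=f(\xi_t(x-1),\xi_t(x))$ for all $x\in\mathbb{Z}$. A configuration $\xi$ is periodic if there is $\sigma>0$ with $\xi(x)=\xi(x+\sigma)$ for all $x$; the smallest such $\sigma$ is its spatial period. A configuration $\xi$ with spatial period (exactly) $\sigma$ is a periodic solution (PS) of $f$ with spatial period $\sigma$ and temporal period $\tau$ if, starting from $\xi_0=\xi$, one has $\xi_\tau=\xi_0$ and $\tau\ge1$ is the smallest integer with this property. $X_{\sigma,n}(f)$ and $Y_{\sigma,n}(f)$ denote, respectively, the largest and the smallest temporal period among all PS of $f$ with spatial period $\sigma$ (the equality in the claim includes that at least one such PS exists). *)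

(* Defs.v *)
From mathcomp Require Import all_boot all_order all_algebra.
From mathcomp Require Import reals.

Set Implicit Arguments.
Unset Strict Implicit.
Unset Printing Implicit Defensive.

Import Order.TTheory GRing.Theory Num.Theory.
Local Open Scope ring_scope.

Definition config (n : nat) := int -> 'I_n.

Definition ca_rule (n : nat) := 'I_n * 'I_n -> 'I_n.

Definition ca_step n (f : ca_rule n) (xi : config n) : config n :=
  fun x => f (xi (x - 1), xi x).

Definition trajectory n (f : ca_rule n) (xi0 : config n) (t : nat) : config n :=
  iter t (ca_step f) xi0.

Definition least_positive (P : nat -> Prop) (k : nat) : Prop :=
  [/\ (0 < k)%N, P k & forall j : nat, (0 < j)%N -> P j -> (k <= j)%N].

Definition spatial_period n (xi : config n) (sigma : nat) : Prop :=
  least_positive (fun s => forall x : int, xi x = xi (x + s%:Z)) sigma.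

Definition temporal_period n (f : ca_rule n) (xi : config n) (tau : nat) : Prop :=
  least_positive (fun t => trajectory f xi t =1 xi) tau.

Definition periodic_solution n (f : ca_rule n) (sigma tau : nat)
    (xi : config n) : Prop :=
  spatial_period xi sigma /\ temporal_period f xi tau.

Definition is_temporal_period_of_PS n (f : ca_rule n) (sigma tau : nat) : Prop :=
  exists xi : config n, periodic_solution f sigma tau xi.

(* X_{sigma,n}(f) = X and Y_{sigma,n}(f) = Y are relations rather than
   functions: each contains the existence of a periodic solution of f with
   spatial period sigma, without which neither extremum is defined. *)
Definition largest_temporal_period n (f : ca_rule n) (sigma X : nat) : Prop :=
  is_temporal_period_of_PS f sigma X /\
  forall tau : nat, is_temporal_period_of_PS f sigma tau -> (tau <= X)%N.

Definition smallest_temporal_period n (f : ca_rule n) (sigma Y : nat) : Prop :=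
  is_temporal_period_of_PS f sigma Y /\
  forall tau : nat, is_temporal_period_of_PS f sigma tau -> (Y <= tau)%N.

(* Main.v *)
(** Arrange the cells of a period-[sigma] configuration as the digits of an
    odometer in base [m], with [m] of order [n / sigma].  A state is either a
    pair (position in Z/sigma, digit in [0, m]) or dead.  A cell dies unless its
    position is the successor of its left neighbor's, and death spreads to the
    right, so for [sigma >= 2] a non-constant periodic solution has consistent
    positions.  The digit [m] stands for "0, with a carry to the right neighbor";
    the carry is read one step later, and after delaying the [i]-th digit by [i]
    steps the dynamics is exactly adding 1 modulo [m ^ sigma].  For [sigma = 1]
    the dead configuration would itself be a solution, of period 1; there the
    rule adding 1 to each cell does. *)
Require Import Defs.
From mathcomp Require Import all_boot all_order all_algebra.
From mathcomp Require Import reals.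
From mathcomp Require Import zify.

Set Implicit Arguments.
Unset Strict Implicit.
Unset Printing Implicit Defensive.

Import Order.TTheory GRing.Theory Num.Theory.
Local Open Scope ring_scope.

(** * Arithmetic of an odometer with delayed carries *)

Section Odometer.
Local Open Scope nat_scope.
Variables (m sigma : nat) (u : nat -> nat -> nat).

(** The lowest digit receives a carry at every step; this is the 1 being added. *)
Definition carry_in i t := (i == 0) || (u i.-1 t == m).

Hypothesis m_gt0 : 0 < m.
Hypothesis u_le : forall i t, u i t <= m.
Hypothesis uS : forall i t, i < sigma -> u i t.+1 = u i t %% m + carry_in i t.

Definition delayed_value k t := \sum_(i < k) u i (t + i) %% m * m ^ i.

Lemma delayed_value_lt k t : delayed_value k t < m ^ k.
Proof.
rewrite /delayed_value; elim: k => [|k IHk]; first by rewrite big_ord0 expn0.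
rewrite big_ord_recr /= expnS.
have ltv : u k (t + k) %% m < m by rewrite ltn_mod.
apply: leq_trans (leq_mul ltv (leqnn (m ^ k))).
by rewrite mulSn ltn_add2r.
Qed.

(** The term in [m ^ k] is the carry leaving the [k] lowest digits, which digit [k] reads at time
    [t + k]. In the induction that digit absorbs it, and passes on a carry exactly when it becomes
    [m]. *)
Lemma delayed_valueS k t : k <= sigma ->
  delayed_value k t.+1 + m ^ k * carry_in k (t + k) = (delayed_value k t).+1.
Proof.
rewrite /delayed_value; elim: k => [|k IHk] lek; first by rewrite !big_ord0.
rewrite !big_ord_recr /= /carry_in /= addSn addnS.
have := IHk (ltnW lek).
have := u_le k (t + k).+1.
have uE := uS (t + k) lek.
have -> : u k (t + k).+1 %% m = u k (t + k).+1 - m * (u k (t + k).+1 == m).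
  case: eqP => [->|/eqP neq]; first by rewrite modnn muln1 subnn.
  by rewrite muln0 subn0 modn_small // ltn_neqAle neq u_le.
rewrite uE expnS.
set v := u k (t + k) %% m; set c := carry_in k (t + k).
move=> _; move: (\sum_(i < k) _) (\sum_(i < k) _) (m ^ k) v c => D D' M v c IHe.
have := mulnDl v c M; rewrite (mulnC c).
case: eqP => [->|_]; rewrite ?muln1 ?muln0 ?subn0 ?subnn ?mul0n; lia.
Qed.

Lemma delayed_value_mod k t s : k <= sigma ->
  delayed_value k (t + s) = (delayed_value k t + s) %% m ^ k.
Proof.
move=> lek; elim: s => [|s IHs].
  by rewrite !addn0 modn_small // delayed_value_lt.
rewrite addnS -[LHS](modn_small (delayed_value_lt k _)).
rewrite -[LHS](modnMDl (carry_in k (t + s + k))) addnC mulnC delayed_valueS //.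
by rewrite IHs -addn1 modnDml addn1 addnS.
Qed.

(** Delayed values see digits only modulo [m] and confuse [m] with 0. The identity [uE] recovers the
    unreduced digit at time [(r + i).+1] from delayed values, hence the wait of [sigma] steps. *)
Lemma odometer_periodic i t : i < sigma -> sigma <= t ->
  u i (t + m ^ sigma) = u i t.
Proof.
move=> lti let_.
have per k r : k <= sigma -> delayed_value k (r + m ^ sigma) = delayed_value k r.
  move=> lek; rewrite delayed_value_mod // -(subnKC lek) expnD mulnC.
  by rewrite addnC modnMDl modn_small // delayed_value_lt.
have uE r : m ^ i * u i (r + i).+1 + delayed_value i r.+1 =
    (delayed_value i.+1 r).+1.
  have := delayed_valueS r (ltnW lti).
  rewrite uS // /delayed_value big_ord_recr /=.
  set v := u i (r + i) %% m; nia.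
have -> : t = (t - i.+1 + i).+1 by lia.
move: (t - i.+1) => r.
have perS : delayed_value i (r + m ^ sigma).+1 = delayed_value i r.+1.
  by rewrite -addSn per // ltnW.
have := uE (r + m ^ sigma); rewrite perS per // -(uE r) => /eqP.
rewrite eqn_add2r eqn_pmul2l ?expn_gt0 ?m_gt0 // => /eqP <-.
by congr (u i _); lia.
Qed.

Lemma odometer_period_dvd s :
  (forall i t, i < sigma -> u i (t + s) = u i t) -> m ^ sigma %| s.
Proof.
move=> per; have := delayed_value_mod 0 s (leqnn sigma).
have -> : delayed_value sigma (0 + s) = delayed_value sigma 0.
  by apply: eq_bigr => i _; rewrite add0n addnC per.
rewrite -{1}(modn_small (delayed_value_lt sigma 0)) => /eqP.
by rewrite -{1}[delayed_value _ _]addn0 eqn_modDl mod0n eq_sym.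
Qed.

End Odometer.

(** * Trajectories and temporal periods for an arbitrary rule *)

Lemma trajectoryS n (f : ca_rule n) xi t x :
  trajectory f xi t.+1 x = f (trajectory f xi t (x - 1), trajectory f xi t x).
Proof. by []. Qed.

Lemma trajectory_ext n (f : ca_rule n) xi xi' t :
  xi =1 xi' -> trajectory f xi t =1 trajectory f xi' t.
Proof. by move=> e; elim: t => // t IH x; rewrite !trajectoryS !IH. Qed.

Lemma trajectoryD n (f : ca_rule n) xi s t :
  trajectory f xi (s + t) = trajectory f (trajectory f xi t) s.
Proof. exact: iterD. Qed.

Lemma trajectory_period n (f : ca_rule n) xi s t :
  trajectory f xi s =1 xi -> trajectory f xi (t + s) =1 trajectory f xi t.
Proof. by move=> per x; rewrite trajectoryD; apply: trajectory_ext. Qed.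

Lemma trajectory_mul n (f : ca_rule n) xi s k :
  trajectory f xi s =1 xi -> trajectory f xi (k * s) =1 xi.
Proof.
move=> per; elim: k => // k IH x.
by rewrite mulSn addnC trajectory_period.
Qed.

Lemma unique_temporal_period n (f : ca_rule n) sigma T :
    (exists xi, periodic_solution f sigma T xi) ->
    (forall tau xi, periodic_solution f sigma tau xi -> tau = T) ->
  largest_temporal_period f sigma T /\ smallest_temporal_period f sigma T.
Proof.
by move=> ex uniq; split; split=> // tau [xi /uniq ->].
Qed.

(** * The odometer rule and its periodic solutions *)

Section OdometerRule.
(* [sigma = s.+2], so that positions form the ring ['I_sigma]. *)
Variables (s m n : nat).
Hypothesis m_gt0 : (0 < m)%N.
Hypothesis size_ok : (s.+2 * m.+1 < n)%N.
Local Notation sigma := s.+2.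
Local Notation state := ('I_sigma * 'I_m.+1)%type.

Let n_gt0 : (0 < n)%N. Proof. exact: leq_trans size_ok. Qed.
Let rank_lt (q : state) : (enum_rank q < n)%N.
Proof.
apply: leq_trans (ltn_ord _) _; apply: leq_trans (ltnW size_ok).
by rewrite card_prod !card_ord.
Qed.
Let enc (q : state) : 'I_n := Ordinal (rank_lt q).
Let dead_lt : (n.-1 < n)%N. Proof. by rewrite prednK. Qed.
Let dead : 'I_n := Ordinal dead_lt.

Let enc_inj : injective enc.
Proof. by move=> q q' [/ord_inj/enum_rank_inj]. Qed.

Let enc_neq_dead q : enc q != dead.
Proof.
rewrite -val_eqE /= neq_ltn; apply/orP; left.
apply: leq_trans (ltn_ord _) _.
by rewrite card_prod !card_ord -ltnS prednK.
Qed.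

(** All values outside the image of [enc] decode to [None], so the rule treats surplus states like
    [dead]. *)
Let dec (v : 'I_n) : option state := [pick q | enc q == v].

Let encK q : dec (enc q) = Some q.
Proof.
rewrite /dec; case: pickP => [q' /eqP/enc_inj -> //|/(_ q)].
by rewrite eqxx.
Qed.

Let decK v q : dec v = Some q -> v = enc q.
Proof. by rewrite /dec; case: pickP => // q' /eqP <- [->]. Qed.

Let dec_dead : dec dead = None.
Proof. by rewrite /dec; case: pickP => // q; rewrite (negPf (enc_neq_dead q)). Qed.

Let next_digit (p : 'I_sigma) (a b : 'I_m.+1) : 'I_m.+1 :=
  inord (b %% m + ((p == 0%R) || (a == m :> nat))).

Let next_digitE p a b :
  next_digit p a b = (b %% m + ((p == 0%R) || (a == m :> nat)))%N :> nat.
Proof.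
rewrite inordK // ltnS; have : (b %% m < m)%N by rewrite ltn_mod.
by case: (_ || _); lia.
Qed.

Definition odometer_rule : ca_rule n := fun ab =>
  match dec ab.1, dec ab.2 with
  | Some (p, a), Some (q, b) =>
      if q == p + 1 then enc (q, next_digit q a b) else dead
  | _, _ => dead
  end.
Local Notation f := odometer_rule.

Let deadl v : f (dead, v) = dead.
Proof. by rewrite /f /= dec_dead. Qed.
Let deadr v : f (v, dead) = dead.
Proof. by rewrite /f /= dec_dead; case: (dec v) => [[]|]. Qed.

Let alive (xi : config n) (p : int -> 'I_sigma) (u : int -> 'I_m.+1) :=
  (forall x, p x = p (x - 1) + 1) /\ (forall x, xi x = enc (p x, u x)).

Let digits p (u : int -> 'I_m.+1) t :=
  iter t (fun v x => next_digit (p x) (v (x - 1)) (v x)) u.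

Let alive_trajectory xi p u t :
  alive xi p u -> alive (trajectory f xi t) p (digits p u t).
Proof.
case=> pS xiE; split=> //; elim: t => // t IH x.
by rewrite trajectoryS !IH /f /= !encK -pS eqxx.
Qed.

Let position_add (p : int -> 'I_sigma) : (forall x, p x = p (x - 1) + 1) ->
  forall x (i : nat), p (x + i%:Z) = p x + i%:R.
Proof.
move=> pS x; elim=> [|i IH]; first by rewrite !addr0.
by rewrite pS -natr1 addrA -IH; congr (p _ + 1); lia.
Qed.

(** Meant for [x0] of position 0. Such a cell takes a carry whatever its left neighbor's digit, so
    the [sigma] cells from [x0] on form an odometer of their own. *)
Let block_digits p u x0 i t : nat := digits p u t (x0 + i%:Z).

Let block_digitsS p u x0 i t : (forall x, p x = p (x - 1) + 1) -> p x0 = 0 ->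
    (i < sigma)%N ->
  block_digits p u x0 i t.+1 = (block_digits p u x0 i t %% m
    + carry_in m (block_digits p u x0) i t)%N.
Proof.
move=> pS p0 lti; rewrite /block_digits /carry_in /= next_digitE.
congr (_ + nat_of_bool _)%N.
rewrite position_add // p0 add0r -val_eqE /= Zp_nat /= modn_small //.
case: i lti => //= i _; congr (val (digits p u t _) == m); lia.
Qed.

Let block_digits_le p u x0 i t : (block_digits p u x0 i t <= m)%N.
Proof. by rewrite -ltnS ltn_ord. Qed.

Let position_start (p : int -> 'I_sigma) x : (forall x, p x = p (x - 1) + 1) ->
  p (x - (p x : nat)%:Z) = 0.
Proof.
move=> pS; apply: (addIr (p x : nat)%:R).
by rewrite -position_add // subrK add0r natr_Zp.
Qed.

Let alive_recurrent xi p u t : alive xi p u -> (sigma <= t)%N ->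
  trajectory f xi (t + m ^ sigma) =1 trajectory f xi t.
Proof.
move=> al let_ x; have [pS _] := al.
rewrite (alive_trajectory _ al).2 (alive_trajectory _ al).2.
congr (enc (_, _)); apply: val_inj => /=.
(* The cell [x] is digit number [p x] of its block. *)
have := odometer_periodic m_gt0 (block_digits_le p u (x - (p x : nat)%:Z))
  (fun i r => block_digitsS u r pS (position_start x pS)) (ltn_ord (p x)) let_.
by rewrite /block_digits subrK.
Qed.

Let alive_period_dvd xi p u r : alive xi p u ->
  trajectory f xi r =1 xi -> (m ^ sigma %| r)%N.
Proof.
move=> al per; have [pS _] := al.
apply: (odometer_period_dvd m_gt0 (block_digits_le p u (0 - (p 0 : nat)%:Z))
  (fun i t => block_digitsS u t pS (position_start 0 pS))).
move=> i t _; rewrite /block_digits; set x := _ + _.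
have := trajectory_period t per x.
by rewrite !(alive_trajectory _ al).2 => /enc_inj [->].
Qed.

(** Divisibility bounds [tau] from below. For the other bound, [xi] recurs at time
    [sigma * tau >= sigma], past the transient, so it also returns after [m ^ sigma] steps. *)
Let alive_temporal_period xi p u tau : alive xi p u ->
  temporal_period f xi tau -> tau = (m ^ sigma)%N.
Proof.
move=> al [tau_gt0 per min_tau]; apply/eqP; rewrite eqn_leq.
rewrite (dvdn_leq tau_gt0 (alive_period_dvd al per)) andbT.
apply: min_tau; first by rewrite expn_gt0 m_gt0.
move=> x; rewrite -(trajectory_period (m ^ sigma) (trajectory_mul sigma per)).
rewrite addnC (alive_recurrent al) ?trajectory_mul //.
by rewrite leq_pmulr.
Qed.

Let dead_spreads xi x t j r : trajectory f xi t x = dead ->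
  trajectory f xi (t + j + r) (x + j%:Z) = dead.
Proof.
move=> dx; elim: r => [|r IH]; last by rewrite addnS trajectoryS IH deadr.
rewrite addn0; elim: j => [|j IH]; first by rewrite addn0 addr0.
rewrite addnS trajectoryS.
have -> : x + j.+1%:Z - 1 = x + j%:Z by lia.
by rewrite IH deadl.
Qed.

(** A cell dead at time 1 has dead translates arbitrarily far to the left. Their death reaches any
    given cell and lasts until a multiple of [tau], when [xi] reappears; then [xi] is constant, of
    spatial period 1. *)
Let periodic_not_dead xi tau x :
  periodic_solution f sigma tau xi -> trajectory f xi 1 x <> dead.
Proof.
case=> -[_ perx minx] [tau_gt0 per _] dx.
suff xiE y : xi y = dead.
  suff /(minx 1%N isT) : forall y, xi y = xi (y + 1%:Z) by [].
  by move=> y; rewrite !xiE.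
have perxN k z : xi (z - (k * sigma)%N%:Z) = xi z.
  elim: k z => [|k IH] z; first by rewrite subr0.
  rewrite -[RHS]IH [LHS]perx; congr xi; lia.
(* Moving [k] spatial periods to the left of [x] lands at or before [y]. *)
pose k := `|(x - y)%R|%N.
have dk : trajectory f xi 1 (x - (k * sigma)%N%:Z) = dead.
  rewrite -dx !trajectoryS /= perxN; congr (f (_, _)).
  by rewrite -[RHS](perxN k); congr xi; lia.
have [j yE] : exists j : nat, y = x - (k * sigma)%N%:Z + j%:Z.
  exists `|(y - (x - (k * sigma)%N%:Z))%R|%N.
  have : (k <= k * sigma)%N by rewrite leq_pmulr.
  by move: (k * sigma)%N => K; rewrite /k; lia.
rewrite -(trajectory_mul (1 + j) per) yE.
rewrite -(subnKC (leq_pmulr (1 + j) tau_gt0)).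
exact: dead_spreads.
Qed.

(** A cell is not dead at time 1 only if the rule found two valid states with successive positions
    at time 0. *)
Let periodic_alive xi tau : periodic_solution f sigma tau xi ->
  exists p u, alive xi p u.
Proof.
(* The default is never taken, as [ok] shows. *)
move=> ps; pose q x := odflt (0, 0) (dec (xi x)).
have ok x : dec (xi x) = Some (q x) /\ (q x).1 = (q (x - 1)).1 + 1.
  have := periodic_not_dead (x := x) ps; rewrite trajectoryS /= /f /= /q.
  case: (dec (xi (x - 1))) => [[p a]|] //; case: (dec (xi x)) => [[p' b]|] //=.
  by case: eqP.
exists (fun x => (q x).1), (fun x => (q x).2); split=> x; first exact: (ok x).2.
by rewrite -surjective_pairing; apply/decK/(ok x).1.
Qed.

Let periodic_exists : exists xi, periodic_solution f sigma (m ^ sigma) xi.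
Proof.
pose p (x : int) : 'I_sigma := x%:~R.
pose u (x : int) : 'I_m.+1 := 0.
pose xi x := enc (p x, u x).
have al0 : alive xi p u.
  by split=> // x; rewrite /p -[1 in RHS]/(1%:~R) -rmorphD subrK.
have al := alive_trajectory sigma al0.
have T_gt0 : (0 < m ^ sigma)%N by rewrite expn_gt0 m_gt0.
have perp x : p (x + sigma%:Z) = p x.
  rewrite /p rmorphD /= -[X in _ + X]/(sigma%:R).
  by have /= -> := pchar_Zp (isT : (1 < sigma)%N); rewrite addr0.
(* Running [sigma] steps from zero digits gets past the transient. Positions do not change and
   already separate cells that differ modulo [sigma]. *)
exists (trajectory f xi sigma); split; split=> //.
- move=> x; rewrite !al.2 perp; congr (enc (_, _)).
  suff: forall t y, digits p u t (y + sigma%:Z) = digits p u t y by [].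
  elim=> // t IH y; rewrite /= perp !IH; congr (next_digit _ _ _).
  by rewrite -[RHS]IH; congr digits; lia.
- move=> j j_gt0 /(_ 0); rewrite !al.2 => /enc_inj [+ _].
  rewrite /p add0r => /(congr1 val); rewrite /= -[(Posz j)%:~R]/(j%:R) Zp_nat /=.
  by move=> /esym jE; rewrite dvdn_leq // /dvdn jE.
- by move=> x; rewrite -trajectoryD addnC (alive_recurrent al0).
- by move=> j j_gt0 /(alive_period_dvd al); apply: dvdn_leq.
Qed.

Lemma odometer_rule_periods :
  largest_temporal_period f sigma (m ^ sigma) /\
  smallest_temporal_period f sigma (m ^ sigma).
Proof.
apply: unique_temporal_period => // tau xi ps.
have [p [u al]] := periodic_alive ps.
exact: alive_temporal_period al ps.2.
Qed.

End OdometerRule.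

(** * Spatial period 1 *)

Lemma rotation_rule_periods n : let f : ca_rule n.+1 := fun ab => ab.2 + inZp 1 in
  largest_temporal_period f 1 n.+1 /\ smallest_temporal_period f 1 n.+1.
Proof.
move=> f.
have trajE xi t x : trajectory f xi t x = xi x + inZp t.
  elim: t => [|t IH].
    by rewrite -[LHS]addr0; congr (_ + _); apply: val_inj; rewrite /= mod0n.
  rewrite trajectoryS /f /= IH -addrA; congr (_ + _).
  by apply: val_inj; rewrite /= modnDm addn1.
have perE xi t : trajectory f xi t =1 xi <-> (n.+1 %| t)%N.
  split=> [/(_ 0)|/eqP t0 x]; rewrite trajE.
    by rewrite -[RHS]addr0 => /addrI/(congr1 val) /= /eqP.
  by rewrite -[RHS]addr0; congr (_ + _); apply: val_inj.
have per xi : temporal_period f xi n.+1.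
  by split=> // [|j j_gt0 /perE]; [apply: (perE xi n.+1).2 | apply: dvdn_leq].
apply: unique_temporal_period => [|tau xi [_ [tau_gt0 pert mint]]].
  by exists (fun _ => 0); split=> //; split.
apply/eqP; rewrite eqn_leq mint //=; last exact: (perE xi n.+1).2.
by move/perE/dvdn_leq: pert; apply.
Qed.

Theorem theorem1 (R : realType) (sigma : nat) (hsigma : (1 <= sigma)%N) :
  exists (N : nat) (C : R), [/\ (0 < N)%N, 0 < C &
    forall n : nat, (2 <= n)%N -> (N <= n)%N ->
      exists (f : ca_rule n) (X Y : nat),
        [/\ largest_temporal_period f sigma X,
            smallest_temporal_period f sigma Y,
            X = Y &
            C * n%:R ^+ sigma <= X%:R]].
Proof.
case: sigma hsigma => // -[_|s _].
  exists 1%N, 1; split=> // -[//|n] _ _.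
  have [large small] := rotation_rule_periods n.
  by exists (fun ab => ab.2 + inZp 1), n.+1, n.+1; rewrite mul1r expr1.
(* The choice of [m] below gives [n <= (m + 2) * s.+2], which is at most [K * m] because
   [m >= 1]. *)
pose K := (3 * s.+2)%N.
have K_gt0 : 0 < K%:R :> R by rewrite ltr0n.
exists (2 * s.+2).+1, (K%:R ^- s.+2); split=> //; first by rewrite invr_gt0 exprn_gt0.
(* One state is set aside for [dead], and each position needs [m.+1] digits. The threshold on [n]
   makes the quotient at least 2, so [m] is positive. *)
move=> n _ len; pose m := (n.-1 %/ s.+2).-1.
have q_ge2 : (2 <= n.-1 %/ s.+2)%N by rewrite leq_divRL //; lia.
have m_gt0 : (0 < m)%N by rewrite /m; lia.
have mE : m.+1 = (n.-1 %/ s.+2)%N by rewrite /m; lia.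
have size_ok : (s.+2 * m.+1 < n)%N.
  by rewrite mE mulnC; have := leq_divM n.-1 s.+2; lia.
have [large small] := odometer_rule_periods m_gt0 size_ok.
exists (odometer_rule size_ok), (m ^ s.+2)%N, (m ^ s.+2)%N; split=> //.
rewrite mulrC ler_pdivrMr ?exprn_gt0 // natrX -exprMn -natrM lerXn2r ?nnegrE //.
rewrite ler_nat /K; have := ltn_ceil n.-1 (ltn0Sn s.+1); rewrite -mE; nia.
Qed.
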